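(* Let $(\mathcal{A}',\mathcal{A},\mathcal{A}'',i^*,i_*,i^!,j_!,j^*,j_* )$ be a recollement of abelian categories. Assume that $(\mathcal{U}',\mathcal{V}')$ and $(\mathcal{U}'',\mathcal{V}'')$ are cotorsion pairs in $\mathcal{A}'$ and $\mathcal{A}''$, respectively. If $(\mathbb{L}_1j_!)(\mathcal{U}'')=0$, then $({}^{\perp}\mathcal{N}^{\mathcal{V}'}_{\mathcal{V}''},\ \mathcal{N}^{\mathcal{V}'}_{\mathcal{V}''})$ is a cotorsion pair in $\mathcal{A}$. If $(\mathbb{R}_1j_* )(\mathcal{V}'')=0$, then $(\mathcal{M}^{\mathcal{U}'}_{\mathcal{U}''},\ (\mathcal{M}^{\mathcal{U}'}_{\mathcal{U}''})^{\perp})$ is a cotorsion pair in $\mathcal{A}$.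
   Context: All abelian categories are assumed to have enough projective and enough injective objects. All classes of objects (subcategories) are full and closed under isomorphisms. A recollement $(\mathcal{A}',\mathcal{A},\mathcal{A}'',i^*,i_*,i^!,j_!,j^*,j_* )$ of abelian categories consists of functors $i_*:\mathcal{A}'\to\mathcal{A}$, $i^*,i^!:\mathcal{A}\to\mathcal{A}'$, $j^*:\mathcal{A}\to\mathcal{A}''$, $j_!,j_*:\mathcal{A}''\to\mathcal{A}$ such that $(i^*,i_* )$, $(i_*,i^!)$, $(j_!,j^* )$, $(j^*,j_* )$ are adjoint pairs (left adjoint written first), $i_*,j_!,j_*$ are fully faithful, and $\operatorname{Ker} j^*=\operatorname{Im} i_*$. $\mathbb{L}_1F$ denotes the first left derived functor of a right exact functor $F$ and $\mathbb{R}_1F$ the first right derived functor of a left exact functor $F$; $(\mathbb{L}_1F)(\mathcal{C})=0$ means $(\mathbb{L}_1F)(C)=0$ for all $C\in\mathcal{C}$ (similarly for $\mathbb{R}_1$). For a class $\mathcal{C}$ of objects of an abelian category, $\mathcal{C}^\perp=\{X\mid \operatorname{Ext}^1(C,X)=0\ \forall C\in\mathcal{C}\}$ and ${}^\perp\mathcal{C}=\{X\mid \operatorname{Ext}^1(X,C)=0\ \forall C\in\mathcal{C}\}$. A pair $(\mathcal{C},\mathcal{D})$ is a cotorsion pair if $\mathcal{C}^\perp=\mathcal{D}$ and ${}^\perp\mathcal{D}=\mathcal{C}$. For classes $\mathcal{X}\subseteq\mathcal{A}'$ and $\mathcal{Y}\subseteq\mathcal{A}''$: $\mathcal{N}^{\mathcal{X}}_{\mathcal{Y}}=\{X\in\mathcal{A}\mid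 i^!X\in\mathcal{X},\ j^*X\in\mathcal{Y},\ (\mathbb{R}_1i^!)(X)=0\}$, $\mathcal{M}^{\mathcal{X}}_{\mathcal{Y}}=\{X\in\mathcal{A}\mid i^*X\in\mathcal{X},\ j^*X\in\mathcal{Y},\ (\mathbb{L}_1i^* )(X)=0\}$. *)

(* Defs.v *)
From mathcomp Require Import all_boot all_algebra.
From mathcomp Require Import boolp classical_sets.

Set Implicit Arguments.
Unset Strict Implicit.
Unset Printing Implicit Defensive.

Import GRing.Theory.
Local Open Scope ring_scope.
Local Open Scope classical_set_scope.

Record preadditive := Preadditive {
  obj :> Type;
  hom : obj -> obj -> zmodType;
  idm : forall X, hom X X;
  cmp : forall X Y Z, hom Y Z -> hom X Y -> hom X Z;
  cmp1m : forall X Y (f : hom X Y), cmp (idm Y) f = f;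
  cmpm1 : forall X Y (f : hom X Y), cmp f (idm X) = f;
  cmpA : forall X Y Z W (h : hom Z W) (g : hom Y Z) (f : hom X Y),
    cmp h (cmp g f) = cmp (cmp h g) f;
  cmpDl : forall X Y Z (g g' : hom Y Z) (f : hom X Y),
    cmp (g + g') f = cmp g f + cmp g' f;
  cmpDr : forall X Y Z (g : hom Y Z) (f f' : hom X Y),
    cmp g (f + f') = cmp g f + cmp g f' }.

Arguments idm {p} X.
Arguments cmp {p X Y Z}.

Notation "g \oc f" := (cmp g f) (at level 40, left associativity).

Section PreadditiveNotions.
Variable A : preadditive.
Implicit Types X Y Z W : A.

Definition is_zero X :=
  (forall Y (f : hom X Y), f = 0) /\ (forall Y (f : hom Y X), f = 0).

Definition mono X Y (f : hom X Y) :=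
  forall W (u v : hom W X), f \oc u = f \oc v -> u = v.

Definition epi X Y (f : hom X Y) :=
  forall W (u v : hom Y W), u \oc f = v \oc f -> u = v.

Definition iso X Y :=
  exists (f : hom X Y) (g : hom Y X), g \oc f = idm X /\ f \oc g = idm Y.

Definition is_kernel K X Y (k : hom K X) (f : hom X Y) :=
  f \oc k = 0 /\
  forall W (h : hom W X), f \oc h = 0 -> exists! u : hom W K, k \oc u = h.

Definition is_cokernel X Y C (c : hom Y C) (f : hom X Y) :=
  c \oc f = 0 /\
  forall W (h : hom Y W), h \oc f = 0 -> exists! u : hom C W, u \oc c = h.

Record kernel X Y (f : hom X Y) := Kernel {
  kobj : A;
  kmap : hom kobj X;
  kmapP : is_kernel kmap f }.

Record cokernel X Y (f : hom X Y) := Cokernel {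
  cobj : A;
  cmap : hom Y cobj;
  cmapP : is_cokernel cmap f }.

Record biproduct X Y := Biproduct {
  bobj : A;
  inj1 : hom X bobj;
  inj2 : hom Y bobj;
  prj1 : hom bobj X;
  prj2 : hom bobj Y;
  prj1_inj1 : prj1 \oc inj1 = idm X;
  prj2_inj2 : prj2 \oc inj2 = idm Y;
  prj1_inj2 : prj1 \oc inj2 = 0;
  prj2_inj1 : prj2 \oc inj1 = 0;
  inj_prj : inj1 \oc prj1 + inj2 \oc prj2 = idm bobj }.

Definition projective P :=
  forall Y Z (g : hom Y Z) (f : hom P Z), epi g ->
    exists h : hom P Y, g \oc h = f.

Definition injective_obj I :=
  forall Y Z (g : hom Y Z) (f : hom Y I), mono g ->
    exists h : hom Z I, h \oc g = f.

Record proj_presentation X := ProjPresentation {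
  pobj : A;
  pmap : hom pobj X;
  pobj_projective : projective pobj;
  pmap_epi : epi pmap }.

Record inj_presentation X := InjPresentation {
  iobj : A;
  imap : hom X iobj;
  iobj_injective : injective_obj iobj;
  imap_mono : mono imap }.

Lemma cmp0m X Y Z (f : hom X Y) : (0 : hom Y Z) \oc f = 0.
Proof. by apply: (addIr (0 \oc f)); rewrite -cmpDl !add0r. Qed.

Lemma cmpm0 X Y Z (g : hom Y Z) : g \oc (0 : hom X Y) = 0.
Proof. by apply: (addIr (g \oc 0)); rewrite -cmpDr !add0r. Qed.

End PreadditiveNotions.

(* Existence assumptions are structure: a choice of kernels, cokernels and
   biproducts, and a choice of a projective object over and an injective object
   under every object.  Enough projectives and injectives are included. *)
Record abelian := Abelian {
  abelian_preadditive :> preadditive;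
  zero_obj : abelian_preadditive;
  zero_objP : is_zero zero_obj;
  bip : forall X Y : abelian_preadditive, biproduct X Y;
  ker : forall (X Y : abelian_preadditive) (f : hom X Y), kernel f;
  coker : forall (X Y : abelian_preadditive) (f : hom X Y), cokernel f;
  mono_normal : forall (X Y : abelian_preadditive) (f : hom X Y), mono f ->
    exists (Z : abelian_preadditive) (g : hom Y Z), is_kernel f g;
  epi_normal : forall (X Y : abelian_preadditive) (f : hom X Y), epi f ->
    exists (W : abelian_preadditive) (g : hom W X), is_cokernel f g;
  enough_proj : forall X : abelian_preadditive, proj_presentation X;
  enough_inj : forall X : abelian_preadditive, inj_presentation X }.

Section Ext.
Variable A : abelian.
Implicit Types (X Y C : A) (U V : set A).

(* Short exact sequences 0 -> X -> E -> C -> 0. *)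
Record extension C X := Extension {
  ext_obj : A;
  ext_in : hom X ext_obj;
  ext_out : hom ext_obj C;
  ext_inP : is_kernel ext_in ext_out;
  ext_outP : is_cokernel ext_out ext_in }.

Definition ext_equiv C X (E E' : extension C X) :=
  exists (f : hom (ext_obj E) (ext_obj E')) (g : hom (ext_obj E') (ext_obj E)),
    [/\ g \oc f = idm _, f \oc g = idm _,
        f \oc ext_in E = ext_in E' & ext_out E' \oc f = ext_out E].

Lemma inj1_kernel X Y (B : biproduct X Y) : is_kernel (inj1 B) (prj2 B).
Proof.
split; first exact: prj2_inj1.
move=> W h ph0; exists (prj1 B \oc h); split=> [|u <-]; last first.
  by rewrite cmpA prj1_inj1 cmp1m.
by rewrite -[RHS]cmp1m -(inj_prj B) cmpDl -!cmpA ph0 cmpm0 addr0.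
Qed.

Lemma prj2_cokernel X Y (B : biproduct X Y) : is_cokernel (prj2 B) (inj1 B).
Proof.
split; first exact: prj2_inj1.
move=> W h hi0; exists (h \oc inj2 B); split=> [|u <-]; last first.
  by rewrite -cmpA prj2_inj2 cmpm1.
by rewrite -[RHS]cmpm1 -(inj_prj B) cmpDr !cmpA hi0 cmp0m add0r.
Qed.

Definition split_ext C X : extension C X :=
  Extension (inj1_kernel (bip X C)) (prj2_cokernel (bip X C)).

(* The underlying set of Ext^1(C, X) and its zero element. *)
Definition Ext1 C X : set (set (extension C X)) :=
  [set [set E' | ext_equiv E E'] | E in [set: extension C X]].

Definition Ext1_zero C X : set (extension C X) :=
  [set E' | ext_equiv (split_ext C X) E'].

Arguments Ext1 : clear implicits.
Arguments Ext1_zero : clear implicits.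

Definition Ext1_vanishes C X := Ext1 C X = [set Ext1_zero C X].

Definition rperp U : set A := [set X | forall C, U C -> Ext1_vanishes C X].

Definition lperp V : set A := [set X | forall C, V C -> Ext1_vanishes X C].

Definition cotorsion_pair U V := rperp U = V /\ lperp V = U.

End Ext.

Arguments Ext1 {A} C X.
Arguments Ext1_zero {A} C X.

Record functor (A B : preadditive) := Functor {
  fobj :> A -> B;
  fmap : forall X Y : A, hom X Y -> hom (fobj X) (fobj Y);
  fmap1 : forall X, fmap (idm X) = idm (fobj X);
  fmapM : forall X Y Z (g : hom Y Z) (f : hom X Y),
    fmap (g \oc f) = fmap g \oc fmap f;
  fmapD : forall X Y (f g : hom X Y), fmap (f + g) = fmap f + fmap g }.

Lemma fmap0 (A B : preadditive) (F : functor A B) (X Y : A) :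
  fmap F (0 : hom X Y) = 0.
Proof. by apply: (addIr (fmap F (0 : hom X Y))); rewrite -fmapD !add0r. Qed.

Section Homology.
Variables (A : abelian) (X Y Z : A) (f : hom X Y) (g : hom Y Z).
Hypothesis gf0 : g \oc f = 0.

Lemma ker_lift_subproof :
  exists u : hom X (kobj (ker g)), kmap (ker g) \oc u == f.
Proof.
by have [_ /(_ _ f gf0) [u [fE _]]] := kmapP (ker g); exists u; apply/eqP.
Qed.

Definition ker_lift : hom X (kobj (ker g)) := xchoose ker_lift_subproof.

Lemma ker_liftK : kmap (ker g) \oc ker_lift = f.
Proof. exact/eqP/(xchooseP ker_lift_subproof). Qed.

(* The homology object Ker g / Im f. *)
Definition homology : A := cobj (coker ker_lift).

End Homology.

Section ProjectiveResolution.
Variables (A : abelian) (X : A).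

Let P0 := enough_proj X.
Let P1 := enough_proj (kobj (ker (pmap P0))).
Definition pres_d1 : hom (pobj P1) (pobj P0) := kmap (ker (pmap P0)) \oc pmap P1.
Let P2 := enough_proj (kobj (ker pres_d1)).
Definition pres_d2 : hom (pobj P2) (pobj P1) := kmap (ker pres_d1) \oc pmap P2.

Lemma pres_d1d2 : pres_d1 \oc pres_d2 = 0.
Proof. by rewrite /pres_d2 cmpA (kmapP (ker pres_d1)).1 cmp0m. Qed.

End ProjectiveResolution.

Section InjectiveResolution.
Variables (A : abelian) (X : A).

Let I0 := enough_inj X.
Let I1 := enough_inj (cobj (coker (imap I0))).
Definition ires_d0 : hom (iobj I0) (iobj I1) := imap I1 \oc cmap (coker (imap I0)).
Let I2 := enough_inj (cobj (coker ires_d0)).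
Definition ires_d1 : hom (iobj I1) (iobj I2) := imap I2 \oc cmap (coker ires_d0).

Lemma ires_d1d0 : ires_d1 \oc ires_d0 = 0.
Proof. by rewrite /ires_d1 -cmpA (cmapP (coker ires_d0)).1 cmpm0. Qed.

End InjectiveResolution.

Section DerivedFunctors.
Variables (A B : abelian) (F : functor A B).

Lemma fmap_complex (X Y Z : A) (g : hom Y Z) (f : hom X Y) :
  g \oc f = 0 -> fmap F g \oc fmap F f = 0.
Proof. by move=> gf0; rewrite -fmapM gf0 fmap0. Qed.

(* H_1 of F P_2 -> F P_1 -> F P_0, resp. H^1 of F I^0 -> F I^1 -> F I^2, for the
   projective, resp. injective, resolution given by the chosen presentations. *)
Definition L1 (X : A) : B := homology (fmap_complex (pres_d1d2 X)).

Definition R1 (X : A) : B := homology (fmap_complex (ires_d1d0 X)).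

End DerivedFunctors.

(* F is left adjoint to G. *)
Definition adjoint (A B : preadditive) (F : functor A B) (G : functor B A) :=
  exists phi : forall X Y, hom (F X) Y -> hom X (G Y),
    (forall X Y, bijective (@phi X Y)) /\
    (forall (X' X : A) (Y Y' : B) (a : hom X' X) (f : hom (F X) Y) (b : hom Y Y'),
       phi _ _ (b \oc f \oc fmap F a) = fmap G b \oc phi _ _ f \oc a).

Definition fully_faithful (A B : preadditive) (F : functor A B) :=
  forall X Y : A, bijective (@fmap _ _ F X Y).

Definition Ker (A B : preadditive) (F : functor A B) : set A :=
  [set X | is_zero (F X)].

Definition Im (A B : preadditive) (F : functor A B) : set B :=
  [set Y | exists X, iso (F X) Y].

(* Upper and lower decorations: i_ust = i^*, i_lst = i_*, i_ush = i^!,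
   j_lsh = j_!, j_ust = j^*, j_lst = j_*.  Taking all six functors additive is
   no restriction, since adjoint functors between abelian categories are. *)
Record recollement (A' A A'' : abelian) := Recollement {
  i_ust : functor A A';
  i_lst : functor A' A;
  i_ush : functor A A';
  j_lsh : functor A'' A;
  j_ust : functor A A'';
  j_lst : functor A'' A;
  i_ust_lst : adjoint i_ust i_lst;
  i_lst_ush : adjoint i_lst i_ush;
  j_lsh_ust : adjoint j_lsh j_ust;
  j_ust_lst : adjoint j_ust j_lst;
  i_lst_ff : fully_faithful i_lst;
  j_lsh_ff : fully_faithful j_lsh;
  j_lst_ff : fully_faithful j_lst;
  ker_im : Ker j_ust = Im i_lst }.

Section Glueing.
Variables (A' A A'' : abelian) (R : recollement A' A A'').

Definition Nclass (X' : set A') (Y'' : set A'') : set A :=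
  [set X | [/\ X' (i_ush R X), Y'' (j_ust R X) & is_zero (R1 (i_ush R) X)]].

Definition Mclass (X' : set A') (Y'' : set A'') : set A :=
  [set X | [/\ X' (i_ust R X), Y'' (j_ust R X) & is_zero (L1 (i_ust R) X)]].

End Glueing.

(* Main.v *)
From mathcomp Require Import all_boot all_algebra.
From mathcomp Require Import boolp classical_sets.
(* Imported last: [hom] is also a name of the library's vector spaces. *)
Require Import Defs.

(** Both classes are orthogonals of explicit classes: N is the right orthogonal
    of i_* U' together with j_! U'', and M is the left orthogonal of i_* V'
    together with j_* V''.  Everything rests on one adjunction F -| G.  Let
    0 -> K -> P -> X -> 0 be exact with P projective.  Then L_1 F X = 0 iff
    F K -> F P is monic.  Ext^1(X, G Y) = 0 says that every K -> G Y extends to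
    P, equivalently that every F K -> Y extends to F P.  When L_1 F X = 0 and G
    is exact, the latter says Ext^1(F X, Y) = 0.  When it holds for an injective
    Y containing F K, it forces L_1 F X = 0.  The statements on R_1 G follow in
    the opposite categories. *)

Set Implicit Arguments.
Unset Strict Implicit.
Unset Printing Implicit Defensive.

Import GRing.Theory.
Local Open Scope ring_scope.
Local Open Scope classical_set_scope.

(** * Cancellation and universal properties in preadditive categories *)

Section Preadditive.
Variable A : preadditive.
Implicit Types X Y Z W K C : A.

Lemma cmpNl X Y Z (g : hom Y Z) (f : hom X Y) : (- g) \oc f = - (g \oc f).
Proof. by apply: (addIr (g \oc f)); rewrite -cmpDl !addNr cmp0m. Qed.

Lemma cmpNr X Y Z (g : hom Y Z) (f : hom X Y) : g \oc (- f) = - (g \oc f).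
Proof. by apply: (addIr (g \oc f)); rewrite -cmpDr !addNr cmpm0. Qed.

Lemma cmpBl X Y Z (g g' : hom Y Z) (f : hom X Y) :
  (g - g') \oc f = g \oc f - g' \oc f.
Proof. by rewrite cmpDl cmpNl. Qed.

Lemma cmpBr X Y Z (g : hom Y Z) (f f' : hom X Y) :
  g \oc (f - f') = g \oc f - g \oc f'.
Proof. by rewrite cmpDr cmpNr. Qed.

Lemma mono0P X Y (f : hom X Y) :
  mono f <-> forall W (u : hom W X), f \oc u = 0 -> u = 0.
Proof.
split=> [mf W u fu0 | f0 W u v fuv]; first by apply: mf; rewrite fu0 cmpm0.
by apply/subr0_eq/f0; rewrite cmpBr fuv subrr.
Qed.

Lemma kernel_mono K X Y (k : hom K X) (f : hom X Y) : is_kernel k f -> mono k.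
Proof.
move=> [fk0 kP] W u v kuv.
have [|w [_ wu]] := kP W (k \oc u); first by rewrite cmpA fk0 cmp0m.
by rewrite -(wu u) // -(wu v).
Qed.

Lemma cokernel_epi X Y C (c : hom Y C) (f : hom X Y) : is_cokernel c f -> epi c.
Proof.
move=> [cf0 cP] W u v ucv.
have [|w [_ wu]] := cP W (u \oc c); first by rewrite -cmpA cf0 cmpm0.
by rewrite -(wu u) // -(wu v).
Qed.

Lemma kernel_lift K X Y (k : hom K X) (f : hom X Y) W (h : hom W X) :
  is_kernel k f -> f \oc h = 0 -> exists u, k \oc u = h.
Proof. by move=> [_ kP] /kP[u [uh _]]; exists u. Qed.

Lemma cokernel_desc X Y C (c : hom Y C) (f : hom X Y) W (h : hom Y W) :
  is_cokernel c f -> h \oc f = 0 -> exists u, u \oc c = h.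
Proof. by move=> [_ cP] /cP[u [uh _]]; exists u. Qed.

Lemma kernel_intro K X Y (k : hom K X) (f : hom X Y) :
  mono k -> f \oc k = 0 ->
  (forall W (h : hom W X), f \oc h = 0 -> exists u, k \oc u = h) ->
  is_kernel k f.
Proof.
move=> mk fk0 kP; split=> // W h /kP[u uh]; exists u; split=> // v vh.
by apply: mk; rewrite uh vh.
Qed.

Lemma cokernel_intro X Y C (c : hom Y C) (f : hom X Y) :
  epi c -> c \oc f = 0 ->
  (forall W (h : hom Y W), h \oc f = 0 -> exists u, u \oc c = h) ->
  is_cokernel c f.
Proof.
move=> ec cf0 cP; split=> // W h /cP[u uh]; exists u; split=> // v vh.
by apply: ec; rewrite uh vh.
Qed.

Lemma id0_zero X : idm X = 0 -> is_zero X.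
Proof.
by move=> X0; split=> Y f; [rewrite -[f]cmpm1 | rewrite -[f]cmp1m];
  rewrite X0 ?cmpm0 ?cmp0m.
Qed.

(* A self-dual form of exactness at the middle object. *)
Definition exact_at X Y Z (f : hom X Y) (g : hom Y Z) :=
  forall W W' (u : hom W Y) (v : hom Y W'), g \oc u = 0 -> v \oc f = 0 ->
    v \oc u = 0.

End Preadditive.

(** * Exactness in abelian categories *)

Section Abelian.
Variable A : abelian.
Implicit Types X Y Z W K C : A.

(** By normality [m] is the kernel of some [g]. Since [g] kills [m], it factors through [c], so
    whatever [c] kills is killed by [g]. *)
Lemma mono_kernel X Y C (m : hom X Y) (c : hom Y C) :
  mono m -> is_cokernel c m -> is_kernel m c.
Proof.
move=> mm cm; have [Z [g mg]] := mono_normal mm.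
apply: kernel_intro => // [|W h ch0]; first exact: cm.1.
have [t tc] := cokernel_desc cm mg.1.
by apply: (kernel_lift mg); rewrite -tc -cmpA ch0 cmpm0.
Qed.

Lemma epi_cokernel X Y K (e : hom X Y) (k : hom K X) :
  epi e -> is_kernel k e -> is_cokernel e k.
Proof.
move=> ee ke; have [Z [g eg]] := epi_normal ee.
apply: cokernel_intro => // [|W h hk0]; first exact: ke.1.
have [t kt] := kernel_lift ke eg.1.
by apply: (cokernel_desc eg); rewrite -kt cmpA hk0 cmp0m.
Qed.

Lemma homology_zeroP X Y Z (f : hom X Y) (g : hom Y Z) (gf0 : g \oc f = 0) :
  is_zero (homology gf0) <-> exact_at f g.
Proof.
rewrite /homology; set c := coker _; have kP := kmapP (ker g).
split=> [H0 W W' u v gu0 vf0 | ex].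
  have [u' <-] := kernel_lift kP gu0.
  have [|w wc] := cokernel_desc (cmapP c) (h := v \oc kmap (ker g)).
    by rewrite -cmpA ker_liftK.
  by rewrite cmpA -wc (H0.1 _ w) !cmp0m.
(* Let [n] be the kernel of [c] and [v] the cokernel of the monomorphism
   [kmap (ker g) \oc n].  Since [v] kills [f], exactness makes it kill
   [kmap (ker g)], so [n] is split epi. *)
have nP := kmapP (ker (cmap c)); set n := kmap _ in nP.
have [l nl] := kernel_lift nP (cmapP c).1.
have mkn : mono (kmap (ker g) \oc n).
  move=> W u v; rewrite -!cmpA => /(kernel_mono kP); exact: (kernel_mono nP).
pose v := cmap (coker (kmap (ker g) \oc n)).
have vP : is_cokernel v (kmap (ker g) \oc n) by apply: cmapP.
have [|s ks] := kernel_lift (mono_kernel mkn vP) (h := kmap (ker g)).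
  apply: ex; first exact: kP.1.
  have : v \oc (kmap (ker g) \oc (n \oc l)) = 0.
    by rewrite (cmpA _ n) cmpA vP.1 cmp0m.
  by rewrite nl ker_liftK.
have ns : n \oc s = idm _ by apply: (kernel_mono kP); rewrite cmpA ks cmpm1.
apply: id0_zero; apply: (cokernel_epi (cmapP c)).
by rewrite cmp1m cmp0m -[LHS]cmpm1 -ns cmpA nP.1 cmp0m.
Qed.

Lemma exact_at_mono X Y Z C (f : hom X Y) (e : hom Y C) (m : hom C Z) :
  is_cokernel e f -> exact_at f (m \oc e) <-> mono m.
Proof.
move=> ef; split=> [ex | mm W W' u v meu0 /(cokernel_desc ef)[w <-]]; last first.
  rewrite -cmpA (_ : e \oc u = 0) ?cmpm0 //.
  by apply: (mono0P m).1 => //; rewrite cmpA.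
(* Factor [m] through the cokernel [q] of [t]; the epimorphism [q \oc e] has a
   kernel which [e] kills, so [q] is split mono. *)
apply/mono0P => W t mt0; have qP := cmapP (coker t); set q := cmap _ in qP.
have [n nq] := cokernel_desc qP mt0.
have eqe : epi (q \oc e).
  move=> V u v; rewrite !cmpA => /(cokernel_epi ef); exact: (cokernel_epi qP).
have kP := kmapP (ker (q \oc e)); set k := kmap _ in kP.
have [|w we] := cokernel_desc (epi_cokernel eqe kP) (h := e).
  apply: ex; last exact: ef.1.
  by rewrite -nq -(cmpA n) -cmpA kP.1 cmpm0.
have wq : w \oc q = idm _.
  by apply: (cokernel_epi ef); rewrite -cmpA we cmp1m.
by rewrite -[t]cmp1m -wq -cmpA qP.1 cmpm0.
Qed.

(** Write K for the kernel of P0 -> X. As K -> P0 is monic, the kernel of [pres_d1] is also that of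
    the epimorphism P1 -> K, which is therefore its cokernel. Precomposing with the epimorphism from
    P2 keeps this cokernel. *)
Lemma pres_cokernel X :
  is_cokernel (pmap (enough_proj (kobj (ker (pmap (enough_proj X))))))
              (pres_d2 X).
Proof.
rewrite /pres_d2; set P := enough_proj (kobj (ker (pmap (enough_proj X)))).
set Q := enough_proj (kobj (ker (pres_d1 X))); have dP := kmapP (ker (pres_d1 X)).
have mk := kernel_mono (kmapP (ker (pmap (enough_proj X)))).
have kP : is_kernel (kmap (ker (pres_d1 X))) (pmap P).
  apply: kernel_intro => [||W h ph0]; first exact: (kernel_mono dP).
    by apply: mk; rewrite cmpA cmpm0; apply: dP.1.
  by apply: (kernel_lift dP); rewrite -cmpA ph0 cmpm0.
have pk := epi_cokernel (pmap_epi (p := P)) kP.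
apply: cokernel_intro => [||W h]; first exact: pmap_epi.
  by rewrite cmpA kP.1 cmp0m.
rewrite cmpA => hk0; apply: (cokernel_desc pk).
by apply: (pmap_epi (p := Q)); rewrite hk0 cmp0m.
Qed.

(** * Extensions and the vanishing of Ext^1 *)

Section Extensions.
Variables C X : A.

Lemma ext_section (E : extension C X) :
  (exists r, r \oc ext_in E = idm X) <-> (exists s, ext_out E \oc s = idm C).
Proof.
have iP := ext_inP E; have oP := ext_outP E; split=> [[r ri]|[s os]].
  have [|s so] := cokernel_desc oP (h := idm _ - ext_in E \oc r).
    by rewrite cmpBl cmp1m -cmpA ri cmpm1 subrr.
  exists s; apply: (cokernel_epi oP).
  by rewrite -cmpA so cmpBr cmpA oP.1 cmp0m subr0 cmpm1 cmp1m.
have [|r ir] := kernel_lift iP (h := idm _ - s \oc ext_out E).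
  by rewrite cmpBr cmpA os cmpm1 cmp1m subrr.
exists r; apply: (kernel_mono iP).
by rewrite cmpA ir cmpBl -cmpA oP.1 cmpm0 subr0 cmpm1 cmp1m.
Qed.

Lemma ext_equiv_refl (E : extension C X) : ext_equiv E E.
Proof. by exists (idm _), (idm _); rewrite !cmp1m !cmpm1. Qed.

Lemma ext_equiv_sym (E E' : extension C X) : ext_equiv E E' -> ext_equiv E' E.
Proof.
move=> [f [g [gf fg fi fo]]]; exists g, f; split=> //.
  by rewrite -fi cmpA gf cmp1m.
by rewrite -fo -cmpA fg cmpm1.
Qed.

Lemma ext_equiv_trans (E1 E2 E3 : extension C X) :
  ext_equiv E1 E2 -> ext_equiv E2 E3 -> ext_equiv E1 E3.
Proof.
move=> [f [g [gf fg fi fo]]] [f' [g' [gf' fg' fi' fo']]].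
exists (f' \oc f), (g \oc g'); split.
- by rewrite cmpA -(cmpA g) gf' cmpm1.
- by rewrite cmpA -(cmpA f') fg cmpm1.
- by rewrite -cmpA fi.
- by rewrite cmpA fo'.
Qed.

Lemma split_ext_equiv (E : extension C X) :
  ext_equiv (split_ext C X) E <-> exists r, r \oc ext_in E = idm X.
Proof.
rewrite /ext_equiv /=; split=> [[f [g [gf fg fi fo]]] | [r ri]].
  exists (prj1 (bip X C) \oc g).
  by rewrite -fi cmpA -(cmpA _ g) gf cmpm1 prj1_inj1.
have iP := ext_inP E; have oP := ext_outP E.
have [|s so] := cokernel_desc oP (h := idm _ - ext_in E \oc r).
  by rewrite cmpBl cmp1m -cmpA ri cmpm1 subrr.
have rs : r \oc s = 0.
  apply: (cokernel_epi oP).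
  by rewrite -cmpA so cmpBr cmpm1 cmpA ri cmp1m subrr cmp0m.
have os : ext_out E \oc s = idm _.
  apply: (cokernel_epi oP).
  by rewrite -cmpA so cmpBr cmpA oP.1 cmp0m subr0 cmpm1 cmp1m.
pose B := bip X C.
(* The retraction [r] and the section [s] with [r \oc s = 0] exhibit the middle term as a biproduct
   of [X] and [C]. *)
exists (ext_in E \oc prj1 B + s \oc prj2 B).
exists (inj1 B \oc r + inj2 B \oc ext_out E); split.
- rewrite cmpDl !cmpDr !cmpA -!(cmpA (inj1 B)) -!(cmpA (inj2 B)).
  by rewrite ri rs os oP.1 !cmp1m !cmp0m !cmpm0 addr0 add0r inj_prj.
- rewrite cmpDl !cmpDr !cmpA -!(cmpA (ext_in E)) -!(cmpA s).
  rewrite prj1_inj1 prj1_inj2 prj2_inj1 prj2_inj2.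
  by rewrite !cmp1m !cmp0m !cmpm0 addr0 add0r so addrC subrK.
- by rewrite cmpDl -!cmpA prj1_inj1 prj2_inj1 cmpm1 cmpm0 addr0.
- by rewrite cmpDr !cmpA oP.1 os cmp0m cmp1m add0r.
Qed.

Lemma Ext1_vanishesP :
  Ext1_vanishes C X <->
  forall E : extension C X, exists r, r \oc ext_in E = idm X.
Proof.
rewrite /Ext1_vanishes /Ext1 /Ext1_zero; split=> [Ext0 E | spl].
  apply/split_ext_equiv.
  have : [set [set E' | ext_equiv E0 E'] | E0 in [set: extension C X]]
           [set E' | ext_equiv E E'] by exists E.
  (* The class of [E] is the zero class; evaluating both at [E] turns reflexivity into equivalence
     with the split extension. *)
  rewrite Ext0 => /(congr1 (@^~ E)) /= sE.
  have: ext_equiv E E by apply: ext_equiv_refl.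
  by rewrite sE.
rewrite predeqE => S; split=> [[E _ <-] /= | ->]; last by exists (split_ext C X).
have /split_ext_equiv sE := spl E.
rewrite predeqE => E' /=; split=> h; first exact: ext_equiv_trans h.
exact: ext_equiv_trans (ext_equiv_sym sE) h.
Qed.

(** The middle term is the pushout of [k] and [f], built as the cokernel of [b = (k, -f)]. *)
Lemma pushout_extension P K (p : hom P C) (k : hom K P) (f : hom K X) :
  epi p -> is_kernel k p ->
  exists (E : extension C X) (g : hom P (ext_obj E)), g \oc k = ext_in E \oc f.
Proof.
move=> ep kp; have pk := epi_cokernel ep kp; have mk := kernel_mono kp.
pose B := bip P X; pose b := inj1 B \oc k - inj2 B \oc f.
have b1 : prj1 B \oc b = k.
  by rewrite cmpBr !cmpA prj1_inj1 prj1_inj2 cmp0m subr0 cmp1m.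
have mb : mono b.
  by move=> W u v buv; apply: mk; rewrite -b1 -!cmpA buv.
have qP := cmapP (coker b); set q := cmap _ in qP.
have eq := cokernel_epi qP; have bP := mono_kernel mb qP.
have [|o oq] := cokernel_desc qP (h := p \oc prj1 B).
  by rewrite -cmpA b1 kp.1.
(* A map killed by [q \oc inj2 B] comes from some [w] through [b], the kernel of [q]; its first
   component gives [k \oc w = 0]. *)
have mi : mono (q \oc inj2 B).
  apply/mono0P => W u; rewrite -cmpA => /(kernel_lift bP)[w bw].
  have w0 : w = 0.
    by apply: mk; rewrite cmpm0 -b1 -cmpA bw cmpA prj1_inj2 cmp0m.
  by rewrite -[u]cmp1m -(prj2_inj2 B) -cmpA -bw w0 !cmpm0.
have oi : is_cokernel o (q \oc inj2 B).
  apply: cokernel_intro => [||W h hi0].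
  - move=> W u v uov; apply: ep; rewrite -[p]cmpm1 -(prj1_inj1 B).
    by rewrite (cmpA p) -oq !cmpA uov.
  - by rewrite cmpA oq -cmpA prj1_inj2 cmpm0.
  (* Since [q \oc b = 0], restricting this map along [k] gives [h \oc q \oc inj2 B \oc f], which is
     zero. *)
  have [|w wp] := cokernel_desc pk (h := h \oc q \oc inj1 B).
    have: h \oc (q \oc b) = 0 by rewrite qP.1 cmpm0.
    by rewrite /b !cmpBr !cmpA in hi0 * => /subr0_eq ->; rewrite hi0 cmp0m.
  exists w; apply: eq; rewrite -cmpA oq cmpA wp.
  rewrite -[RHS]cmpm1 -(inj_prj B) cmpDr !cmpA.
  by rewrite -(cmpA h q (inj2 B)) hi0 cmp0m addr0.
exists (Extension (mono_kernel mi oi) oi), (q \oc inj1 B) => /=.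
by apply/subr0_eq; rewrite -!cmpA -cmpBr qP.1.
Qed.

(** This is exactness of Hom(P,X) -> Hom(K,X) -> Ext^1(C,X) -> 0, done by hand. A retraction of the
    pushout along [f] extends [f]. Conversely, a lift [h] of [p] restricts to some [f] on [K];
    correcting [h] by an extension of [f] makes it descend to a section. *)
Lemma Ext1_proj P K (p : hom P C) (k : hom K P) :
  projective P -> epi p -> is_kernel k p ->
  Ext1_vanishes C X <-> forall f : hom K X, exists g, g \oc k = f.
Proof.
move=> projP ep kp; rewrite Ext1_vanishesP; split=> [spl f | ext E].
  have [E [g gk]] := pushout_extension f ep kp.
  have [r ri] := spl E; exists (r \oc g).
  by rewrite -cmpA gk cmpA ri cmp1m.
apply/ext_section; have iP := ext_inP E; have oP := ext_outP E.
have [h oh] := projP _ _ _ p (cokernel_epi oP).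
have [|f fi] := kernel_lift iP (h := h \oc k); first by rewrite cmpA oh kp.1.
have [g gk] := ext f.
have [|s sp] := cokernel_desc (epi_cokernel ep kp) (h := h - ext_in E \oc g).
  by rewrite cmpBl -cmpA gk fi subrr.
exists s; apply: ep.
by rewrite -cmpA sp cmpBr oh cmpA oP.1 cmp0m subr0 cmp1m.
Qed.

End Extensions.

Lemma Ext1_projective P X : projective P -> Ext1_vanishes P X.
Proof.
move=> projP; apply/Ext1_vanishesP => E; apply/ext_section.
exact: projP (cokernel_epi (ext_outP E)).
Qed.

Lemma Ext1_injective C I : injective_obj I -> Ext1_vanishes C I.
Proof.
by move=> injI; apply/Ext1_vanishesP => E; apply: injI (kernel_mono (ext_inP E)).
Qed.

(** The two orthogonals form a Galois connection, so applying them three times gives the same as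
    once. *)
Lemma cotorsion_pair_rperp (S : set A) :
  cotorsion_pair (lperp (rperp S)) (rperp S).
Proof.
split=> //; rewrite predeqE => X; split=> [h C SC | h C]; last exact.
by apply: h => Y; apply.
Qed.

Lemma cotorsion_pair_lperp (S : set A) :
  cotorsion_pair (lperp S) (rperp (lperp S)).
Proof.
split=> //; rewrite predeqE => X; split=> [h C SC | h C]; last exact.
by apply: h => Y; apply.
Qed.

End Abelian.

(** * Transport along an adjunction *)

Section Adjunction.
Variables (A B : preadditive) (F : functor A B) (G : functor B A).
Hypothesis FG : adjoint F G.

Lemma adjoint_epi (X Y : A) (f : hom X Y) : epi f -> epi (fmap F f).
Proof.
have [phi [bij nat]] := FG; move=> ef W u v uv; apply: (bij_inj (bij _ _)).
apply: ef; have := congr1 (phi _ _) uv.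
(* Naturality is stated for a triple composite, so an identity is inserted as the outer factor. *)
by rewrite -[u \oc _]cmp1m -[v \oc _]cmp1m !cmpA !nat fmap1 !cmp1m.
Qed.

Lemma adjoint_mono (X Y : B) (f : hom X Y) : mono f -> mono (fmap G f).
Proof.
have [phi [bij nat]] := FG; move=> mf W u v.
have [psi psiK phiK] := bij W X.
rewrite -(phiK u) -(phiK v) -[X in X = _]cmpm1 -[X in _ = X]cmpm1 -!nat fmap1.
by rewrite !cmpm1 => /(bij_inj (bij _ _))/mf ->.
Qed.

Lemma adjoint_extend (K P : A) (k : hom K P) (X : B) :
  (forall f : hom (F K) X, exists g, g \oc fmap F k = f) <->
  (forall f : hom K (G X), exists g, g \oc k = f).
Proof.
have [phi [bij nat]] := FG.
have natl (g : hom (F P) X) : phi _ _ (g \oc fmap F k) = phi _ _ g \oc k.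
  by rewrite -[g \oc _]cmp1m cmpA nat fmap1 cmp1m.
split=> ext f.
  have [psi _ phiK] := bij K X.
  by have [g gk] := ext (psi f); exists (phi _ _ g); rewrite -natl gk phiK.
have [g gk] := ext (phi _ _ f); have [psi _ phiK] := bij P X.
by exists (psi g); apply: (bij_inj (bij _ _)); rewrite natl phiK.
Qed.

Lemma adjoint_cokernel (X Y C : A) (c : hom Y C) (f : hom X Y) :
  is_cokernel c f -> is_cokernel (fmap F c) (fmap F f).
Proof.
move=> cf; apply: cokernel_intro => [||W h hf0].
- exact/adjoint_epi/(cokernel_epi cf).
- by rewrite -fmapM cf.1 fmap0.
have [phi [bij nat]] := FG.
have natl (U V : A) (a : hom U V) (g : hom (F V) W) :
    phi _ _ (g \oc fmap F a) = phi _ _ g \oc a.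
  by rewrite -[g \oc _]cmp1m cmpA nat fmap1 cmp1m.
(* Naturality suffices here: 0 is a composite through 0, and [G] sends 0 to 0. *)
have phi0 (U : A) : phi U W 0 = 0.
  by rewrite -[0](cmp0m W (idm (F U))) -(cmpm1 (0 \oc _)) -[X in _ \oc X]fmap1
             nat fmap0 !cmp0m.
have [|u uc] := cokernel_desc cf (h := phi _ _ h); first by rewrite -natl hf0 phi0.
have [psi _ phiK] := bij C W.
by exists (psi u); apply: (bij_inj (bij _ _)); rewrite natl phiK.
Qed.

Lemma adjoint_projective (P : A) :
  (forall (X Y : B) (f : hom X Y), epi f -> epi (fmap G f)) ->
  projective P -> projective (F P).
Proof.
have [phi [bij nat]] := FG; move=> Gepi projP Y Z g f eg.
have [h gh] := projP _ _ _ (phi _ _ f) (Gepi _ _ _ eg).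
have [psi _ phiK] := bij P Y; exists (psi h); apply: (bij_inj (bij _ _)).
by rewrite -[_ \oc _]cmpm1 -[X in _ \oc X]fmap1 nat phiK cmpm1.
Qed.

End Adjunction.

(** * The first left derived functor of a left adjoint *)

Section LeftDerived.
Variables (A B : abelian) (F : functor A B) (G : functor B A).
Hypothesis FG : adjoint F G.

(** [F] preserves the cokernel P1 -> K of [pres_d2]. Thus F P1 -> F P0 is the cokernel F P1 -> F K
    followed by F K -> F P0, and exactness at F P1 means that the latter is monic. *)
Lemma L1_zeroP (X : A) :
  is_zero (L1 F X) <-> mono (fmap F (kmap (ker (pmap (enough_proj X))))).
Proof.
rewrite /L1 homology_zeroP /pres_d1 fmapM; apply: exact_at_mono.
exact/(adjoint_cokernel FG)/pres_cokernel.
Qed.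

(** [F] carries the projective presentation of [X] to one of [F X], so both sides become extension
    problems matched by [adjoint_extend]. *)
Lemma Ext1_adjoint_L1 (X : A) (Y : B) :
  (forall (Y Z : B) (f : hom Y Z), epi f -> epi (fmap G f)) ->
  is_zero (L1 F X) -> Ext1_vanishes (F X) Y <-> Ext1_vanishes X (G Y).
Proof.
move=> Gepi /L1_zeroP; set P := enough_proj X; set k := ker _ => mFk.
have ep := pmap_epi (p := P); have kP := kmapP k.
have Fp := adjoint_cokernel FG (epi_cokernel ep kP).
have projFP := adjoint_projective FG Gepi (pobj_projective (p := P)).
rewrite (Ext1_proj _ (pobj_projective (p := P)) ep kP) -(adjoint_extend FG).
exact: Ext1_proj projFP (cokernel_epi Fp) (mono_kernel mFk Fp).
Qed.

Lemma L1_zero_Ext1 (X : A) :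
  (forall I : B, injective_obj I -> Ext1_vanishes X (G I)) -> is_zero (L1 F X).
Proof.
move=> ext; apply/L1_zeroP; set P := enough_proj X; set k := ker _.
pose J := enough_inj (F (kobj k)).
have := ext _ (iobj_injective (i := J)).
rewrite (Ext1_proj _ (pobj_projective (p := P)) (pmap_epi (p := P)) (kmapP k)).
rewrite -(adjoint_extend FG) => /(_ (imap J))[g gk] W u v kuv.
by apply: (imap_mono (i := J)); rewrite -gk -!cmpA kuv.
Qed.

End LeftDerived.

(** * Duality through opposite categories *)

Section Opposite.

Definition op_preadditive (A : preadditive) : preadditive.
Proof.
refine (@Preadditive A (fun X Y => hom Y X) (fun X => idm X)
          (fun X Y Z g f => f \oc g) _ _ _ _ _).
- by move=> X Y f; apply: cmpm1.
- by move=> X Y f; apply: cmp1m.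
- by move=> X Y Z W h g f; rewrite cmpA.
- by move=> X Y Z g g' f; apply: cmpDr.
- by move=> X Y Z g f f'; apply: cmpDl.
Defined.

Definition op_biproduct (A : preadditive) (X Y : A) (B : biproduct X Y) :
  @biproduct (op_preadditive A) X Y :=
  @Biproduct (op_preadditive A) X Y (bobj B) (prj1 B) (prj2 B) (inj1 B) (inj2 B)
    (prj1_inj1 B) (prj2_inj2 B) (prj2_inj1 B) (prj1_inj2 B) (inj_prj B).

(** The chosen kernels, cokernels and presentations are swapped too, so the chosen projective
    resolution here is, by conversion, the chosen injective resolution in [A]. *)
Definition op_abelian (A : abelian) : abelian.
Proof.
refine (@Abelian (op_preadditive A) (zero_obj A) _
  (fun X Y => op_biproduct (bip X Y))
  (fun X Y f => @Kernel (op_preadditive A) X Y f _ _ (cmapP (coker f)))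
  (fun X Y f => @Cokernel (op_preadditive A) X Y f _ _ (kmapP (ker f))) _ _
  (fun X => @ProjPresentation (op_preadditive A) X
     (@iobj A X (enough_inj X)) (@imap A X (enough_inj X))
     (fun Y Z => @iobj_injective A X (enough_inj X) Z Y) (@imap_mono A X (enough_inj X)))
  (fun X => @InjPresentation (op_preadditive A) X
     (@pobj A X (enough_proj X)) (@pmap A X (enough_proj X))
     (fun Y Z => @pobj_projective A X (enough_proj X) Z Y) (@pmap_epi A X (enough_proj X)))).
- by have [z1 z2] := zero_objP A; split.
- by move=> X Y f; apply: (@epi_normal A).
- by move=> X Y f; apply: (@mono_normal A).
Defined.

Definition op_functor (A B : preadditive) (F : functor A B) :
  functor (op_preadditive A) (op_preadditive B) :=
  @Functor (op_preadditive A) (op_preadditive B) F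
    (fun X Y f => fmap F f) (fun X => fmap1 F X)
    (fun X Y Z g f => fmapM F f g) (fun X Y f g => fmapD F f g).

Lemma op_adjoint (A B : preadditive) (F : functor A B) (G : functor B A) :
  adjoint F G -> adjoint (op_functor G) (op_functor F).
Proof.
move=> [phi [bij nat]].
(* [bijective] only asserts an inverse; choice yields the family of inverses that serves as the new
   adjunction. *)
have inv X Y : {psi | cancel (phi X Y) psi & cancel psi (phi X Y)}.
  by apply: cid2; have [psi psiK phiK] := bij X Y; exists psi.
exists (fun X Y => let: exist2 psi _ _ := inv Y X in psi); split=> [Y X|].
  by case: (inv X Y) => psi psiK phiK; exists (phi X Y).
move=> Y' Y X X' b f a /=.
case: (inv X Y) => psi _ phiK; case: (inv X' Y') => psi' psiK' _.
have := nat _ _ _ _ a (psi f) b; rewrite phiK => natE; apply: (canLR psiK').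
exact: etrans (etrans (cmpA _ _ _) (esym natE)) (congr1 _ (esym (cmpA _ _ _))).
Qed.

(** Reversing an extension exchanges retractions and sections, which exist together by
    [ext_section]. *)
Lemma op_Ext1 (A : abelian) (C X : A) :
  @Ext1_vanishes (op_abelian A) X C <-> Ext1_vanishes C X.
Proof.
rewrite !Ext1_vanishesP; split=> spl E.
  apply/ext_section.
  exact: (spl (@Extension (op_abelian A) X C _ _ _ (ext_outP E) (ext_inP E))).
apply/ext_section.
exact: (spl (@Extension A C X _ _ _ (ext_outP E) (ext_inP E))).
Qed.

(** [homology] as a quotient of a kernel is not literally self-dual, so both sides pass through
    [exact_at]. *)
Lemma op_L1 (A B : abelian) (G : functor A B) (X : A) :
  is_zero (@L1 (op_abelian A) (op_abelian B) (op_functor G) X) <->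
  is_zero (R1 G X).
Proof.
rewrite /L1 /R1 !homology_zeroP; split=> ex W W' u v gu0 vf0.
  exact: (ex W' W v u).
exact: (ex W' W v u).
Qed.

End Opposite.

(** * The dual statements for right derived functors *)

Section RightDerived.
Variables (A B : abelian) (F : functor A B) (G : functor B A).
Hypothesis FG : adjoint F G.

Lemma Ext1_adjoint_R1 (X : A) (Y : B) :
  (forall (X Y : A) (f : hom X Y), mono f -> mono (fmap F f)) ->
  is_zero (R1 G Y) -> Ext1_vanishes (F X) Y <-> Ext1_vanishes X (G Y).
Proof.
move=> Fmono /op_L1 G0; rewrite -(op_Ext1 (F X)) -(op_Ext1 X); symmetry.
apply: (@Ext1_adjoint_L1 (op_abelian B) (op_abelian A) _ _ (op_adjoint FG)) => //.
by move=> ? ? f; apply: Fmono.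
Qed.

Lemma R1_zero_Ext1 (Y : B) :
  (forall P : A, projective P -> Ext1_vanishes (F P) Y) -> is_zero (R1 G Y).
Proof.
move=> ext; apply/op_L1.
apply: (@L1_zero_Ext1 (op_abelian B) (op_abelian A) _ _ (op_adjoint FG)) => P projP.
by apply/op_Ext1/ext => Y' Z; apply: projP.
Qed.

End RightDerived.

(** * The glued classes as orthogonals *)

Section Glueing.
Variables (A' A A'' : abelian) (R : recollement A' A A'').
Variables (U' V' : set A') (U'' V'' : set A'').
Hypotheses (hU' : cotorsion_pair U' V') (hU'' : cotorsion_pair U'' V'').

Lemma Nclass_rperp : (forall X, U'' X -> is_zero (L1 (j_lsh R) X)) ->
  Nclass R V' V'' = rperp (i_lst R @` U' `|` j_lsh R @` U'').
Proof.
move=> L0; rewrite predeqE => X.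
(* i_* is a right adjoint and j^* a left adjoint, which gives the exactness that the two Ext
   comparisons require. *)
have imono := @adjoint_mono _ _ _ _ (i_ust_lst R).
have jepi := @adjoint_epi _ _ _ _ (j_ust_lst R).
have extj C : U'' C -> _ :=
  fun UC => Ext1_adjoint_L1 (j_lsh_ust R) X jepi (L0 C UC).
have exti C := @Ext1_adjoint_R1 _ _ _ _ (i_lst_ush R) C X imono.
split=> [[iX jX R0] _ [[C UC <-]|[C UC <-]] | ext].
- by apply/(exti C R0); move: iX; rewrite -hU'.1; apply.
- by apply/(extj C UC); move: jX; rewrite -hU''.1; apply.
(* This comes first because [exti] depends on it; it holds because U' contains every projective
   object. *)
have R0 : is_zero (R1 (i_ush R) X).
  apply: (R1_zero_Ext1 (i_lst_ush R)) => P projP; apply: ext; left; exists P => //.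
  by rewrite -hU'.2 => C _; apply: Ext1_projective.
split=> //.
- by rewrite -hU'.1 => C UC; apply/(exti C R0); apply: ext; left; exists C.
- by rewrite -hU''.1 => C UC; apply/(extj C UC); apply: ext; right; exists C.
Qed.

Lemma Mclass_lperp : (forall X, V'' X -> is_zero (R1 (j_lst R) X)) ->
  Mclass R U' U'' = lperp (i_lst R @` V' `|` j_lst R @` V'').
Proof.
move=> R0; rewrite predeqE => X.
have iepi := @adjoint_epi _ _ _ _ (i_lst_ush R).
have jmono := @adjoint_mono _ _ _ _ (j_lsh_ust R).
have extj C : V'' C -> _ :=
  fun VC => Ext1_adjoint_R1 (j_ust_lst R) X jmono (R0 C VC).
have exti C := @Ext1_adjoint_L1 _ _ _ _ (i_ust_lst R) X C iepi.
split=> [[iX jX L0] _ [[C VC <-]|[C VC <-]] | ext].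
- by apply/(exti C L0); move: iX; rewrite -hU'.2; apply.
- by apply/(extj C VC); move: jX; rewrite -hU''.2; apply.
(* Dually, V' contains every injective object. *)
have L0 : is_zero (L1 (i_ust R) X).
  apply: (L1_zero_Ext1 (i_ust_lst R)) => I injI; apply: ext; left; exists I => //.
  by rewrite -hU'.1 => C _; apply: Ext1_injective.
split=> //.
- by rewrite -hU'.2 => C VC; apply/(exti C L0); apply: ext; left; exists C.
- by rewrite -hU''.2 => C VC; apply/(extj C VC); apply: ext; right; exists C.
Qed.

End Glueing.

Theorem theorem1p1 (A' A A'' : abelian) (R : recollement A' A A'')
    (U' V' : set A') (U'' V'' : set A'')
    (hU' : cotorsion_pair U' V') (hU'' : cotorsion_pair U'' V'') :
  ((forall X, U'' X -> is_zero (L1 (j_lsh R) X)) ->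
     cotorsion_pair (lperp (Nclass R V' V'')) (Nclass R V' V'')) /\
  ((forall X, V'' X -> is_zero (R1 (j_lst R) X)) ->
     cotorsion_pair (Mclass R U' U'') (rperp (Mclass R U' U''))).
Proof.
split=> [L0 | R0].
  rewrite (Nclass_rperp hU' hU'' L0); exact: cotorsion_pair_rperp.
rewrite (Mclass_lperp hU' hU'' R0); exact: cotorsion_pair_lperp.
Qed.
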